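(* Let $\mathcal{H}$ be an infinite-dimensional separable Hilbert space and let $\{g_j\}_{j\in\Lambda}\subset\mathcal{H}$ be a Bessel sequence with optimal Bessel bound $\beta>0$. Then, for each $T=[a_{ij}]_{i,j\in\Lambda}\in\mathcal{B}^{s}(\ell^2(\Lambda),\ell^\infty(\Lambda))$, the limit $$\lim T\{g_j\}_{j\in\Lambda}:=\lim_{|i|\to\infty}\sum_{j\in\Lambda}a_{ij}g_j$$ exists in $\mathcal{H}$ (in norm). Moreover, the mapping $$\mathscr{R}:\mathcal{B}^{s}(\ell^2(\Lambda),\ell^\infty(\Lambda))\to\mathcal{H},\qquad T\mapsto \lim T\{g_j\}_{j\in\Lambda},$$ is a well-defined bounded operator whose operator norm is precisely $\sqrt{\beta}$.
   Context: Let $N\in\mathbb{N}$, $N\ge 1$, and let $r$ be a fixed odd integer coprime with $N$ with $1\le r\le 2N-1$. Put $\Lambda=\{0,\tfrac{r}{N}\}+2\mathbb{Z}\subset\mathbb{R}$. The Hilbert space $\mathcal{H}$ is real or complex with scalar field $\mathbb{F}\in\{\mathbb{R},\mathbb{C}\}$; all sequences and matrices have entries in $\mathbb{F}$. $\ell^2(\Lambda)$ and $\ell^\infty(\Lambda)$ are the usual square-summable and bounded sequence spaces indexed by $\Lambda$. A family $\{g_j\}_{j\in\Lambda}\subset\mathcal{H}$ is a Bessel sequence with Bessel bound $\beta$ if $\sum_{j\in\Lambda}|\langle f,g_j\rangle|^2\le\beta\|f\|^2$ for all $f\in\mathcal{H}$; the optimal Bessel bound is the smallest such $\beta$. $\mathcal{B}(\ell^2(\Lambda),\ell^\infty(\Lambda))$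 is the space of doubly infinite matrices $T=[a_{ij}]_{i,j\in\Lambda}$ whose rows $r_i=(a_{ij})_{j\in\Lambda}$ all belong to $\ell^2(\Lambda)$ and satisfy $\sup_{i\in\Lambda}\|r_i\|_{\ell^2(\Lambda)}<\infty$, with norm $\|T\|=\sup_{i\in\Lambda}\|r_i\|_{\ell^2(\Lambda)}$. $\mathcal{B}^{s}(\ell^2(\Lambda),\ell^\infty(\Lambda))$ is the subspace, with the induced norm, of those $T$ for which there is $z\in\ell^2(\Lambda)$ with $\lim_{|i|\to\infty}\|r_i-z\|_{\ell^2(\Lambda)}=0$. Here $|i|\to\infty$ refers to $i\in\Lambda\subset\mathbb{R}$ with its absolute value. *)

(* Defs.v *)
From HB Require Import structures.
From mathcomp Require Import all_boot all_order all_algebra.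
From mathcomp Require Import all_classical all_reals all_analysis.
From mathcomp Require Import ring complex.
From mathcomp Require summability.

Set Implicit Arguments.
Unset Strict Implicit.
Unset Printing Implicit Defensive.

Import Order.TTheory GRing.Theory Num.Theory.
Import numFieldNormedType.Exports.

Local Open Scope classical_set_scope.
Local Open Scope ring_scope.

Variant scalar_kind := RealScalars | ComplexScalars.

Definition scalar_field (R : realType) (k : scalar_kind) : numFieldType :=
  match k with
  | RealScalars => R
  | ComplexScalars => R[i]
  end.

Definition scalar_conj (R : realType) (k : scalar_kind) :
    involutive_rmorphism (scalar_field R k) :=
  match k with
  | RealScalars => idfun
  | ComplexScalars => Num.conj
  end.

Definition scalar_re (R : realType) (k : scalar_kind) : scalar_field R k -> R :=
  match k with
  | RealScalars => idfun
  | ComplexScalars => @complex.Re R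
  end.

(* MathComp norms over F take their values in F itself; rnorm is the same
   nonnegative number seen in R. *)
Definition rnorm (R : realType) (k : scalar_kind)
    (V : normedZmodType (scalar_field R k)) (x : V) : R := scalar_re `|x|.

Definition infinite_dimensional (F : fieldType) (V : lmodType F) : Prop :=
  ~ exists (n : nat) (e : 'I_n -> V), forall x : V,
      exists c : 'I_n -> F, x = \sum_(i < n) c i *: e i.

Definition separable_space (T : topologicalType) : Prop :=
  exists2 D : set T, countable D & dense D.

Definition Lambda_set (R : realType) (N r : nat) : set R :=
  [set x | exists m : int,
     x = 0 + 2 * m%:~R \/ x = r%:R / N%:R + 2 * m%:~R].
Arguments Lambda_set : clear implicits.

Section l2.
Variables (R : realType) (k : scalar_kind) (I : choiceType).
Local Notation F := (scalar_field R k).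

Definition l2_sqnorm (x : I -> F) : \bar R :=
  (\esum_(j in [set: I]) ((rnorm (x j)) ^+ 2)%:E)%E.

Definition l2 : set (I -> F) := [set x | (l2_sqnorm x < +oo)%E].

Definition l2_norm (x : I -> F) : R := Num.sqrt (fine (l2_sqnorm x)).

Definition bessel_bound (H : normedModType F) (ip : H -> H -> F)
    (g : I -> H) (b : R) : Prop :=
  forall f : H,
    (\esum_(j in [set: I]) ((rnorm (ip f (g j))) ^+ 2)%:E
       <= (b * rnorm f ^+ 2)%:E)%E.

Definition optimal_bessel_bound (H : normedModType F) (ip : H -> H -> F)
    (g : I -> H) (b : R) : Prop :=
  bessel_bound ip g b /\ forall b', bessel_bound ip g b' -> b <= b'.

End l2.

Section l2_theory.
Variables (R : realType) (k : scalar_kind).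
Local Notation F := (scalar_field R k).

Lemma rnorm_ge0 (V : normedZmodType F) (x : V) : 0 <= rnorm x.
Proof.
rewrite /rnorm; have := normr_ge0 x; case: k V x => /= V x //.
by rewrite lecE => /andP[_].
Qed.

Lemma rnorm0 (V : normedZmodType F) : rnorm (0 : V) = 0.
Proof. by rewrite /rnorm normr0; case: k V. Qed.

Lemma rnormD (V : normedZmodType F) (x y : V) :
  rnorm (x + y) <= rnorm x + rnorm y.
Proof.
rewrite /rnorm; have := ler_normD x y.
move: `|x + y| `|x| `|y|; clear; case: k => //= -[a a'] [b b'] [c c'].
by rewrite lecE => /andP[_].
Qed.

Lemma rnormM (a b : F) : rnorm (a * b) = rnorm a * rnorm b.
Proof.
rewrite /rnorm normrM; have := normr_ge0 a; have := normr_ge0 b.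
move: `|a| `|b|; clear; case: k => //= -[a a'] [b b'].
rewrite !lecE /= => /andP[/eqP -> _] /andP[/eqP -> _].
by rewrite mulr0 subr0.
Qed.

Variable I : choiceType.
Implicit Types x y : I -> F.

Lemma l2_sqnorm_ge0 x : (0 <= l2_sqnorm x)%E.
Proof. by apply: esum_ge0 => j _; rewrite lee_fin sqr_ge0. Qed.

Lemma l2_sqnorm0 : l2_sqnorm (0 : I -> F) = 0%E.
Proof. by rewrite /l2_sqnorm esum1// => j _; rewrite rnorm0 expr0n. Qed.

Lemma l2_normE x : l2 x -> l2_sqnorm x = (l2_norm x ^+ 2)%:E.
Proof.
move=> x2; rewrite /l2_norm sqr_sqrtr ?fine_ge0 ?l2_sqnorm_ge0// fineK//.
by rewrite ge0_fin_numE// l2_sqnorm_ge0.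
Qed.

Lemma l2_sqnormZD (a : F) x y : (l2_sqnorm (a *: x + y)%R
  <= (2 * rnorm a ^+ 2)%:E * l2_sqnorm x + 2%:E * l2_sqnorm y)%E.
Proof.
have le_Z (c : R) z : 0 <= c ->
    (\esum_(j in [set: I]) (c * rnorm (z j) ^+ 2)%:E <= c%:E * l2_sqnorm z)%E.
  move=> c0; apply: ge_ereal_sup => _ [A [finA _] <-].
  under eq_fsbigr do rewrite EFinM.
  rewrite -ge0_mule_fsumr; last by move=> j; rewrite lee_fin sqr_ge0.
  rewrite lee_wpmul2l ?lee_fin//.
  by rewrite /l2_sqnorm esum_ge//; exists A.
apply: (@le_trans _ _ (\esum_(j in [set: I])
   ((2 * rnorm a ^+ 2 * rnorm (x j) ^+ 2)%:E + (2 * rnorm (y j) ^+ 2)%:E))%E).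
  apply: le_esum => j _; rewrite -EFinD lee_fin -mulrA -exprMn -mulrDr -rnormM.
  have := rnormD (a * x j) (y j); have := rnorm_ge0 (a * x j + y j).
  rewrite [(_ + _) j]/(a * x j + y j).
  move: (rnorm (_ * _)) (rnorm (y j)) (rnorm (_ + _)) => u v w w0 wuv.
  apply: (@le_trans _ _ ((u + v) ^+ 2)); first by rewrite lerXn2r ?nnegrE// (le_trans w0).
  by rewrite -subr_ge0 (_ : _ - _ = (u - v) ^+ 2) ?sqr_ge0//; ring.
rewrite esumD; last 2 first.
- by move=> j _; rewrite lee_fin !mulr_ge0 ?rnorm_ge0 ?sqr_ge0.
- by move=> j _; rewrite lee_fin !mulr_ge0 ?rnorm_ge0 ?sqr_ge0.
by rewrite leeD// le_Z// mulr_ge0// sqr_ge0.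
Qed.

Lemma l2ZD (a : F) x y : l2 x -> l2 y -> l2 (a *: x + y).
Proof.
move=> x2 y2; rewrite /l2/=; apply: (le_lt_trans (l2_sqnormZD _ _ _)).
by rewrite (l2_normE x2) (l2_normE y2) -!EFinM -EFinD ltry.
Qed.

Lemma l2_normZD (a : F) x y : l2 x -> l2 y ->
  l2_norm (a *: x + y) <=
  Num.sqrt (2 * rnorm a ^+ 2 * l2_norm x ^+ 2 + 2 * l2_norm y ^+ 2).
Proof.
move=> x2 y2; rewrite ler_wsqrtr// -lee_fin fineK; last first.
  by rewrite ge0_fin_numE ?l2_sqnorm_ge0//; exact: l2ZD.
by rewrite (le_trans (l2_sqnormZD _ _ _))// (l2_normE x2) (l2_normE y2) EFinD !EFinM.
Qed.

End l2_theory.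

Section matrix_spaces.
Variables (R : realType) (k : scalar_kind) (N r : nat).
Local Notation F := (scalar_field R k).
Local Notation L := (Lambda_set R N r).
Implicit Types T : L -> L -> F.

(* neighbourhoods of |i| -> oo, for i ranging over Lambda *)
Definition Lambda_oo : set_system L :=
  filter_from [set: R] (fun M => [set i : L | M < `|val i|]).

Definition B_l2_linfty : set (L -> L -> F) :=
  [set T | (forall i, l2 (T i)) /\ has_ubound (range (fun i => l2_norm (T i)))].

Definition B_norm T : R := sup (range (fun i => l2_norm (T i))).

Definition Bs_l2_linfty : set (L -> L -> F) :=
  [set T | B_l2_linfty T /\
    exists2 z : L -> F, l2 z &
      (fun i => l2_norm (T i - z)) @ Lambda_oo --> (0 : R)].

Definition Bs_mem : {pred L -> L -> F} := mem Bs_l2_linfty.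

Global Instance Lambda_oo_filter : Filter Lambda_oo.
Proof.
apply: filter_fromT_filter; first by exists 0.
move=> M M'; exists (Num.max M M') => i /=.
by rewrite gt_max => /andP[].
Qed.

Lemma Bs_submod_closed : submod_closed Bs_mem.
Proof.
have l20 : l2 (0 : L -> F) by rewrite /l2 /= l2_sqnorm0 ltry.
have n0 : l2_norm (0 : L -> F) = 0 by rewrite /l2_norm l2_sqnorm0 sqrtr0.
split.
  apply/mem_set; split; first split => //.
    by exists 0 => _ [i _ <-]; rewrite n0.
  exists 0 => //; apply: cvg_near_cst; apply: nearW => i.
  by rewrite subr0 n0.
move=> a S T /set_mem[[S2 [b Sb]] [z z2 Sz]] /set_mem[[T2 [c Tc]] [w w2 Tw]].
apply/mem_set; split; first split.
- by move=> i; exact: l2ZD.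
- exists (Num.sqrt (2 * rnorm a ^+ 2 * b ^+ 2 + 2 * c ^+ 2)) => _ [i _ <-].
  apply: (le_trans (l2_normZD _ (S2 i) (T2 i))); rewrite ler_wsqrtr// lerD//.
    have c0 : 0 <= 2 * rnorm a ^+ 2 by rewrite mulr_ge0// sqr_ge0.
    rewrite (ler_wpM2l c0)// lerXn2r ?nnegrE ?sqrtr_ge0//.
      by apply: (le_trans (sqrtr_ge0 _)); apply: Sb; exists i.
    by apply: Sb; exists i.
  rewrite ler_wpM2l// lerXn2r ?nnegrE ?sqrtr_ge0//.
    by apply: (le_trans (sqrtr_ge0 _)); apply: Tc; exists i.
  by apply: Tc; exists i.
- exists (a *: z + w); first exact: l2ZD.
  have l2B x y : l2 x -> l2 y -> l2 (x - y : L -> F).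
    by move=> x2 y2; rewrite addrC -scaleN1r; exact: l2ZD.
  apply: (@squeeze_cvgr _ _ _ _ (cst 0) (fun i => Num.sqrt
    (2 * rnorm a ^+ 2 * l2_norm (S i - z) ^+ 2 + 2 * l2_norm (T i - w) ^+ 2))).
  + apply: nearW => i; rewrite sqrtr_ge0/=.
    rewrite (_ : _ - _ = a *: (S i - z) + (T i - w)).
      by apply: l2_normZD; exact: l2B.
    by rewrite scalerBr opprD addrACA.
  + exact: cvg_cst.
  + rewrite -sqrtr0; apply: (@cvg_comp _ _ _ _ (@Num.sqrt R)); last exact: sqrt_continuous.
    have := cvgD (cvgM (cvg_cst (2 * rnorm a ^+ 2)) (cvgM Sz Sz))
                 (cvgM (cvg_cst (2 : R)) (cvgM Tw Tw)).
    by rewrite !mulr0 addr0; apply.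
Qed.

HB.instance Definition _ := GRing.isSubmodClosed.Build _ _ Bs_mem
  Bs_submod_closed.

Record Bs := Build_Bs {
  Bs_matrix :> L -> L -> F ;
  Bs_matrixP : Bs_matrix \in Bs_mem }.

HB.instance Definition _ := [isSub for Bs_matrix].
HB.instance Definition _ := [Choice of Bs by <:].
HB.instance Definition _ := [SubChoice_isSubLmodule of Bs by <:].

Variable H : normedModType F.

(* \sum_(j in Lambda) T i j *: g j, as the limit of the net of finite sums *)
Definition row_sum (g : L -> H) T (i : L) : H :=
  summability.sum (fun j => T i j *: g j).

(* lim returns a default value when there is no limit, as does summability.sum *)
Definition lim_mx (g : L -> H) (T : Bs) : H := lim (row_sum g T @ Lambda_oo).

Definition bounded_op (A : Bs -> H) : Prop :=
  exists M : R, forall T : Bs, rnorm (A T) <= M * B_norm T.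

Definition op_norm (A : Bs -> H) : R :=
  sup [set rnorm (A T) | T in [set T : Bs | B_norm T <= 1]].

End matrix_spaces.

Arguments Lambda_oo : clear implicits.

(* Main.v *)
(* The synthesis map a |-> \sum_j a_j g_j is the adjoint of the analysis map
   f |-> (<f, g_j>)_j, so b is a Bessel bound of g if and only if
   |\sum_(j in A) a_j g_j|^2 <= b \sum_(j in A) |a_j|^2 for all finite A.
   Synthesis is therefore defined and bounded on l2, and it turns the convergence
   T_i --> z of the rows of T in l2 into the convergence of the row sums to the
   synthesis of z; this gives the limit and the upper bound sqrt beta. Applying
   the operator to matrices whose rows all equal one finitely supported sequence
   shows that the square of its norm is a Bessel bound, hence at least beta. *)

Require Import Defs.
From mathcomp Require Import all_boot all_order all_algebra.
From mathcomp Require Import all_classical all_reals all_analysis.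
From mathcomp Require summability.
From mathcomp Require Import finmap complex ring lra.
Set Implicit Arguments.
Unset Strict Implicit.

Import Order.TTheory GRing.Theory Num.Theory.
Import numFieldNormedType.Exports.

Local Open Scope classical_set_scope.
Local Open Scope ring_scope.

(** An [esum] is the supremum of its finite partial sums, so Bessel and [l2] bounds become bounds
    over [{fset I}]. *)
Lemma esum_fset_le (R : realType) (I : choiceType) (f : I -> R) (b : R) :
  (forall i, 0 <= f i) ->
  (\esum_(i in [set: I]) (f i)%:E <= b%:E)%E <->
  forall A : {fset I}, \sum_(i <- A) f i <= b.
Proof.
move=> f0; split=> [fb A|fb].
  rewrite -lee_fin (le_trans _ fb)//; apply: esum_ge.
  exists [set` A]; first by split => //; exact: finite_fset.
  by rewrite fsbig_finite//= set_fsetK sumEFin.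
apply: ge_ereal_sup => _ [A [finA _] <-].
by rewrite fsbig_finite//= sumEFin lee_fin.
Qed.

(** * Transfer between the scalar field and the reals *)

Section scalars.
Variables (R : realType) (k : scalar_kind).
Local Notation F := (scalar_field R k).

(** Norms take values in [F] but estimates are made in [R]; this embedding carries inequalities from
    one to the other. *)
Definition of_real (x : R) : F :=
  match k return R -> scalar_field R k with
  | RealScalars => idfun
  | ComplexScalars => real_complex R
  end x.

Lemma norm_of_real (V : normedZmodType F) (x : V) : `|x| = of_real (rnorm x).
Proof.
rewrite /rnorm /of_real; have := normr_ge0 x; move: `|x|; clear.
by case: k => //= -[a b]; rewrite lecE /= => /andP[/eqP ->].
Qed.

Lemma ler_of_real (x y : R) : (of_real x <= of_real y) = (x <= y).
Proof. by rewrite /of_real; case: k => //=; rewrite lecR. Qed.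

Lemma ltr_of_real (x y : R) : (of_real x < of_real y) = (x < y).
Proof. by rewrite /of_real; case: k => //=; rewrite ltcR. Qed.

Lemma of_realM (x y : R) : of_real (x * y) = of_real x * of_real y.
Proof. by rewrite /of_real; case: k => //=; rewrite rmorphM. Qed.

Lemma of_realX (x : R) n : of_real (x ^+ n) = of_real x ^+ n.
Proof. by rewrite /of_real; case: k => //=; rewrite rmorphXn. Qed.

Lemma of_real0 : of_real 0 = 0.
Proof. by rewrite /of_real; case: k. Qed.

Lemma of_realD (x y : R) : of_real (x + y) = of_real x + of_real y.
Proof. by rewrite /of_real; case: k => //=; rewrite rmorphD. Qed.

Lemma of_real_sum I (s : seq I) (f : I -> R) :
  of_real (\sum_(i <- s) f i) = \sum_(i <- s) of_real (f i).
Proof. exact: (big_morph _ of_realD of_real0). Qed.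

Lemma of_real_inj : injective of_real.
Proof. by move=> x y; rewrite /of_real; case: k => //= -[]. Qed.

(** In the order of [R[i]], positive elements have zero imaginary part. *)
Lemma of_real_gt0P (e : F) : 0 < e -> exists2 d : R, 0 < d & e = of_real d.
Proof.
rewrite /of_real; case: k e => /= [e e0|[a b]]; first by exists e.
by rewrite ltcE /= => /andP[/eqP -> a0]; exists a.
Qed.

Lemma rnorm_of_real (x : R) : 0 <= x -> rnorm (of_real x) = x.
Proof.
move=> x0; apply: of_real_inj.
by rewrite -norm_of_real ger0_norm// -of_real0 ler_of_real.
Qed.

Lemma scalar_conjM (a : F) : a * scalar_conj R k a = of_real (rnorm a ^+ 2).
Proof.
rewrite of_realX -norm_of_real; case: k a => /= a.
  by rewrite -expr2 real_normK// num_real.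
by rewrite normCK.
Qed.

Lemma scalar_conjK : involutive (scalar_conj R k).
Proof. exact: rmorphK. Qed.

Lemma rnorm_conj (a : F) : rnorm (scalar_conj R k a) = rnorm a.
Proof.
apply/eqP; rewrite -(eqrXn2 (ltn0Sn 1)) ?rnorm_ge0//; apply/eqP/of_real_inj.
by rewrite -!scalar_conjM scalar_conjK mulrC.
Qed.

Lemma rnormN (V : normedZmodType F) (x : V) : rnorm (- x) = rnorm x.
Proof. by rewrite /rnorm normrN. Qed.

Lemma rnorm_eq0 (V : normedZmodType F) (x : V) : (rnorm x == 0) = (x == 0).
Proof.
by rewrite -(inj_eq of_real_inj) of_real0 -norm_of_real normr_eq0.
Qed.

Lemma rnormZ (V : normedModType F) (a : F) (x : V) :
  rnorm (a *: x) = rnorm a * rnorm x.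
Proof. by apply: of_real_inj; rewrite of_realM -!norm_of_real normrZ. Qed.

Lemma rnorm_sum (V : normedZmodType F) I (s : seq I) (f : I -> V) :
  rnorm (\sum_(i <- s) f i) <= \sum_(i <- s) rnorm (f i).
Proof.
by rewrite -ler_of_real of_real_sum -norm_of_real (le_trans (ler_norm_sum _ _ _))//;
  apply: ler_sum => i _; rewrite norm_of_real.
Qed.

Lemma cvg_rnormP (V : normedModType F) T (G : set_system T) (FG : Filter G)
    (f : T -> V) (l : V) :
  f @ G --> l <-> forall e : R, 0 < e -> \forall x \near G, rnorm (l - f x) < e.
Proof.
split=> [/cvgrPdist_lt fl e e0|fl].
  have := fl (of_real e); rewrite -of_real0 ltr_of_real => /(_ e0).
  by apply: filterS => x; rewrite norm_of_real ltr_of_real.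
apply/cvgrPdist_lt => _ /of_real_gt0P[e e0 ->]; have := fl e e0.
by apply: filterS => x; rewrite norm_of_real ltr_of_real.
Qed.

Lemma rnorm_lim_le (V : normedModType F) T (G : set_system T)
    (FG : ProperFilter G) (f : T -> V) (l : V) (c : R) :
  f @ G --> l -> (forall x, rnorm (f x) <= c) -> rnorm l <= c.
Proof.
move=> /cvg_rnormP fl fc; apply/ler_addgt0Pr => e e0.
have [x lx] := filter_ex (fl e e0).
rewrite -[l](subrK (f x)) (le_trans (rnormD _ _))// addrC lerD//; exact: ltW.
Qed.

(** * Cauchy-Schwarz in a real or complex inner product space *)

Section inner_product.
Variables (H : normedModType F) (ip : {dot H for scalar_conj R k}).
Hypothesis ip_norm : forall x : H, `|x| ^+ 2 = ip x x.

Lemma ip_normE (x : H) : ip x x = of_real (rnorm x ^+ 2).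
Proof. by rewrite -ip_norm of_realX -norm_of_real. Qed.

Lemma ipC (x y : H) : ip x y = scalar_conj R k (ip y x).
Proof. by rewrite hermC expr0 mul1r. Qed.

Lemma ipZl (a : F) (x y : H) : ip (a *: x) y = a * ip x y.
Proof. exact: linearZl_LR. Qed.

Lemma ipZr (a : F) (x y : H) : ip x (a *: y) = scalar_conj R k a * ip x y.
Proof. exact: linearZr_LR. Qed.

Lemma ipBl (x y z : H) : ip (x - y) z = ip x z - ip y z.
Proof. exact: linearBl. Qed.

Lemma ipBr (x y z : H) : ip x (y - z) = ip x y - ip x z.
Proof. exact: linearBr. Qed.

Lemma ip_suml J (s : seq J) (f : J -> H) (y : H) :
  ip (\sum_(j <- s) f j) y = \sum_(j <- s) ip (f j) y.
Proof. exact: linear_sumlz. Qed.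

Lemma ip_sumr J (s : seq J) (f : J -> H) (x : H) :
  ip x (\sum_(j <- s) f j) = \sum_(j <- s) ip x (f j).
Proof. exact: linear_sumr. Qed.

Lemma ip_cauchy_schwarz (u v : H) : rnorm (ip u v) <= rnorm u * rnorm v.
Proof.
have [->|v0] := eqVneq v 0; first by rewrite raddf0 !rnorm0 mulr0.
rewrite -(@ler_pXn2r _ 2) ?nnegrE ?mulr_ge0 ?rnorm_ge0//.
have vv0 : ip v v != 0.
  by rewrite ip_normE -of_real0 (inj_eq of_real_inj) sqrf_eq0 rnorm_eq0.
have vv_gt0 : 0 < ip v v.
  rewrite ip_normE -of_real0 ltr_of_real exprn_gt0// lt_neqAle eq_sym rnorm_eq0 v0.
  exact: rnorm_ge0.
(* [c *: v] is the orthogonal projection of [u] on [v]; the claim is that [u - c *: v] has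
   nonnegative squared norm. *)
pose c := ip u v / ip v v.
rewrite -ler_of_real exprMn -scalar_conjM -ipC.
rewrite of_realM -!ip_normE.
rewrite -ler_pdivrMr// -subr_ge0.
suff -> : ip u u - ip u v * ip v u / ip v v = ip (u - c *: v) (u - c *: v).
  by rewrite -ip_norm exprn_ge0.
have cc : scalar_conj R k c = ip v u / ip v v.
  by rewrite fmorph_div [ip v u]ipC [in RHS](ipC v v).
rewrite ipBl !ipBr !ipZl !ipZr cc /c.
move: (ip u u) (ip u v) (ip v u) (ip v v) vv0 => p q r s s0.
by rewrite (divfK s0) subrr subr0 [q * r]mulrC mulrAC.
Qed.

(** * Bessel bounds as bounds on finite synthesis sums *)

Section synthesis.
Variables (I : choiceType) (g : I -> H).
Implicit Types (A B : {fset I}) (a : I -> F) (b : R).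

(** With [v] the sum, |v|^2 is at most the sum of |a_j| |<v, g_j>|. AM-GM and the Bessel inequality
    at [v] bound this by b/2 times the sum of |a_j|^2, plus |v|^2 / 2, which is absorbed on the
    left. *)
Lemma synthesis_le b A a : 0 < b -> bessel_bound ip g b ->
  rnorm (\sum_(j <- A) a j *: g j) ^+ 2 <= b * \sum_(j <- A) rnorm (a j) ^+ 2.
Proof.
move=> b0 gb; set v := \sum_(j <- A) _.
have gv : \sum_(j <- A) rnorm (ip v (g j)) ^+ 2 <= b * rnorm v ^+ 2.
  by apply: (iffLR (esum_fset_le _ _)) => [j|]; [exact: sqr_ge0 | exact: gb].
have vv : rnorm v ^+ 2 <= \sum_(j <- A) rnorm (a j) * rnorm (ip v (g j)).
  (* Only the second [v] in [ip v v] is expanded, which leaves the Bessel coefficients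
     [ip v (g j)]. *)
  rewrite -[leLHS]rnorm_of_real ?sqr_ge0// -ip_normE {2}/v ip_sumr.
  rewrite (le_trans (rnorm_sum _ _))//; apply: ler_sum => j _.
  by rewrite ipZr rnormM rnorm_conj.
(* AM-GM in the form [2 s t <= b s^2 + t^2 / b] *)
have : \sum_(j <- A) rnorm (a j) * rnorm (ip v (g j)) <=
    \sum_(j <- A) (b / 2 * rnorm (a j) ^+ 2 + (2 * b)^-1 * rnorm (ip v (g j)) ^+ 2).
  apply: ler_sum => j _; move: (rnorm _) (rnorm _) => t s.
  rewrite -subr_ge0 (_ : _ - _ = (2 * b)^-1 * (b * s - t) ^+ 2).
    by rewrite mulr_ge0 ?sqr_ge0// invr_ge0 mulr_ge0// ltW.
  by field; rewrite gt_eqF.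
rewrite big_split /= -!mulr_sumr => /(le_trans vv); move: gv.
move: (rnorm v ^+ 2) (\sum_(j <- A) _) (\sum_(j <- A) _) => x z y yx.
have : (2 * b)^-1 * y <= x / 2; last by lra.
rewrite (_ : x / 2 = (2 * b)^-1 * (b * x)).
  by rewrite ler_wpM2l// invr_ge0 mulr_ge0// ltW.
by field; rewrite gt_eqF.
Qed.

(** The coefficients [ip f (g j)] give a sum [w] with <w, f> = s. Cauchy-Schwarz yields s^2 <= |w|^2
    |f|^2 <= b s |f|^2, and division by [s] leaves the Bessel inequality. *)
Lemma synthesis_le_bessel b : 0 <= b ->
  (forall A a, rnorm (\sum_(j <- A) a j *: g j) ^+ 2 <=
     b * \sum_(j <- A) rnorm (a j) ^+ 2) ->
  bessel_bound ip g b.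
Proof.
move=> b0 gb f; apply/esum_fset_le => [j|A]; first exact: sqr_ge0.
set s := \sum_(j <- A) _.
have s0 : 0 <= s by apply: sumr_ge0 => j _; exact: sqr_ge0.
have := gb A (fun j => ip f (g j)); set w := \sum_(j <- A) _ => ws.
have ipwf : ip w f = of_real s.
  rewrite /w ip_suml of_real_sum; apply: eq_bigr => j _.
  by rewrite ipZl [ip (g j) f]ipC scalar_conjM.
have := ip_cauchy_schwarz w f; rewrite ipwf rnorm_of_real// => swf.
have s2 : s ^+ 2 <= b * s * rnorm f ^+ 2.
  rewrite (@le_trans _ _ (rnorm w ^+ 2 * rnorm f ^+ 2))//.
    by rewrite -exprMn ler_pXn2r ?nnegrE ?mulr_ge0 ?rnorm_ge0.
  by rewrite ler_wpM2r ?sqr_ge0.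
have [s00|sn0] := eqVneq s 0; first by rewrite s00 mulr_ge0 ?sqr_ge0.
by rewrite -(@ler_pM2l _ s) ?lt_neqAle 1?eq_sym ?sn0// -expr2 mulrCA mulrA.
Qed.

End synthesis.
End inner_product.
End scalars.

(** * Tails of square-summable families *)

Section sums_in_l2.
Variables (I : choiceType).

Lemma sum_fsetD (V : zmodType) (A B : {fset I}) (f : I -> V) : (A `<=` B)%fset ->
  \sum_(j <- (B `\` A)%fset) f j = \sum_(j <- B) f j - \sum_(j <- A) f j.
Proof.
move=> AB; rewrite (big_fsetID _ (mem A) B) /= addrAC.
rewrite [X in X - _](@eq_fbigl _ _ _ _ _ A) ?subrr ?add0r.
  by apply: eq_fbigl => j; rewrite !inE andbC.
by move=> j; rewrite !inE andb_idl//; apply: (fsubsetP AB).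
Qed.

Variables (R : realType) (k : scalar_kind).
Local Notation F := (scalar_field R k).
Implicit Types (A B : {fset I}) (x : I -> F).

Lemma l2_sqnorm_finite_support A x : (forall j, j \notin A -> x j = 0) ->
  l2_sqnorm x = (\sum_(j <- A) rnorm (x j) ^+ 2)%:E.
Proof.
move=> xA; rewrite -sumEFin -[in RHS](set_fsetK A) -fsbig_finite//.
rewrite -esum_fset//; last by move=> j _; rewrite lee_fin sqr_ge0.
rewrite [in RHS]esum_mkcond; apply: eq_esum => j _.
by case: ifPn => //; rewrite notin_setE /= => /negP/xA ->; rewrite rnorm0 expr0n.
Qed.

(** A finite set whose partial sum is within [e] of the supremum leaves less than [e] to the rest of
    any larger finite set. *)
Lemma l2_tail x (e : R) : l2 x -> 0 < e ->
  exists A, forall B, (A `<=` B)%fset ->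
    \sum_(j <- (B `\` A)%fset) rnorm (x j) ^+ 2 < e.
Proof.
move=> x2 e0; have := l2_normE x2; rewrite /l2_sqnorm => nx.
have := @ub_ereal_sup_adherent R _ e e0.
move/(_ [set \sum_(j \in A) ((rnorm (x j)) ^+ 2)%:E | A in fsets setT]%E).
rewrite -/(esum _ _) nx => /(_ isT)[_ [C [finC _] <-]].
rewrite fsbig_finite// sumEFin -EFinB lte_fin => xC.
exists (fset_set C) => B CB; rewrite sum_fsetD//.
have : \sum_(j <- B) rnorm (x j) ^+ 2 <= l2_norm x ^+ 2.
  apply: (iffLR (esum_fset_le _ _)) => [j|]; first exact: sqr_ge0.
  by rewrite nx.
by move: xC; lra.
Qed.

End sums_in_l2.

(** * The synthesis operator on square-summable sequences *)

Section synthesis_operator.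
Variables (R : realType) (k : scalar_kind).
Local Notation F := (scalar_field R k).
Variables (H : completeNormedModType F) (ip : {dot H for scalar_conj R k}).
Hypothesis ip_norm : forall x : H, `|x| ^+ 2 = ip x x.
Variables (I : choiceType) (g : I -> H) (b : R).
Hypotheses (b0 : 0 < b) (gb : bessel_bound ip g b).
Implicit Types (A B : {fset I}) (a : I -> F).
Local Notation totally := (@summability.totally I).

(** [row_sum g T i] unfolds to [synthesis g (T i)], so results on this operator apply to rows
    directly. *)
Definition synthesis a : H := summability.sum (fun j => a j *: g j).

Lemma partial_sumE a A :
  summability.partial_sum (fun j => a j *: g j) A = \sum_(j <- A) a j *: g j.
Proof. by rewrite /summability.partial_sum big_seq_fsetE. Qed.

Global Instance totally_proper : ProperFilter totally.
Proof. exact: summability.totally_filter. Qed.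

Lemma synthesis_is_cvg a : l2 a ->
  cvg (summability.partial_sum (fun j => a j *: g j) @ totally).
Proof.
move=> a2; apply: cauchy_cvg; apply: cauchy_exP => _ /of_real_gt0P[e e0 ->].
(* [synthesis_le] multiplies the tail by [b], so this threshold keeps the squared distance below
   [e ^+ 2]. *)
have [|A tailA] := @l2_tail _ _ _ a (e ^+ 2 / b) a2.
  by rewrite divr_gt0// exprn_gt0.
exists (\sum_(j <- A) a j *: g j); exists A => // B /= AB.
rewrite -ball_normE /= distrC partial_sumE -sum_fsetD// norm_of_real ltr_of_real.
rewrite -(@ltr_pXn2r _ 2) ?nnegrE ?rnorm_ge0 ?(ltW e0)//.
apply: (le_lt_trans (synthesis_le ip_norm _ _ b0 gb)).
by rewrite mulrC -ltr_pdivlMr// tailA.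
Qed.

Lemma synthesis_cvg a : l2 a ->
  summability.partial_sum (fun j => a j *: g j) @ totally --> synthesis a.
Proof. exact: synthesis_is_cvg. Qed.

Lemma rnorm_synthesis_le a : l2 a ->
  rnorm (synthesis a) <= Num.sqrt b * l2_norm a.
Proof.
move=> a2; apply: (rnorm_lim_le _ (synthesis_cvg a2)) => A.
rewrite -(@ler_pXn2r _ 2) ?nnegrE ?rnorm_ge0 ?mulr_ge0 ?sqrtr_ge0//.
rewrite partial_sumE exprMn sqr_sqrtr ?(ltW b0)//.
apply: (le_trans (synthesis_le ip_norm _ _ b0 gb)); rewrite ler_pM2l//.
apply: (iffLR (esum_fset_le _ _)) => [j|]; first exact: sqr_ge0.
by rewrite -l2_normE.
Qed.

(** Square-summability makes both sums converge, so the limit laws apply to the partial sums. *)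
Lemma synthesisZD (c : F) a a' : l2 a -> l2 a' ->
  synthesis (c *: a + a') = c *: synthesis a + synthesis a'.
Proof.
move=> a2 a'2; apply: (cvg_lim (@norm_hausdorff _ _)).
rewrite (_ : summability.partial_sum _ = fun A =>
    c *: summability.partial_sum (fun j => a j *: g j) A
    + summability.partial_sum (fun j => a' j *: g j) A); last first.
  apply/funext => A; rewrite !partial_sumE scaler_sumr -big_split /=.
  by apply: eq_bigr => j _; rewrite scalerA -scalerDl.
by apply: cvgD; [apply: cvgZr|]; exact: synthesis_cvg.
Qed.

Lemma synthesis_finite_support A a : (forall j, j \notin A -> a j = 0) ->
  synthesis a = \sum_(j <- A) a j *: g j.
Proof.
move=> aA; apply: (cvg_lim (@norm_hausdorff _ _)); apply: cvg_near_cst.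
exists A => // B /= AB; rewrite partial_sumE; apply/esym/big_fset_incl => //.
by move=> j _ /aA ->; rewrite scale0r.
Qed.

End synthesis_operator.

(** * The index set and matrices with constant rows *)

Section Lambda.
Variables (R : realType) (k : scalar_kind) (N r : nat).
Local Notation F := (scalar_field R k).
Local Notation L := (Lambda_set R N r).

Lemma Lambda_mem_even (m : int) : 0 + 2 * m%:~R \in L.
Proof. by apply/mem_set; exists m; left. Qed.

(** These elements witness that the index set is nonempty and unbounded. *)
Definition Lambda_even (m : int) : L := SigSub (Lambda_mem_even m).

Global Instance Lambda_oo_proper : ProperFilter (Lambda_oo R N r).
Proof.
split; last exact: Lambda_oo_filter.
(* Twice the successor of the integer part of |M| exceeds [M], so no set of the filter base is
   empty. *)
move=> [M _ /(_ (Lambda_even (Num.truncn `|M|).+1%:Z))]; apply => /=.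
rewrite add0r ger0_norm ?mulr_ge0 ?ler0n//.
rewrite (le_lt_trans (ler_norm M))// (lt_trans (truncnS_gt _))//.
by rewrite -[ltLHS]mul1r ltr_pM2r ?ltr0n// ltr1n.
Qed.

Lemma const_Bs_mem (z : L -> F) : l2 z -> (fun _ => z) \in @Bs_mem R k N r.
Proof.
move=> z2; apply/mem_set; split.
  by split => //; exists (l2_norm z) => _ [i _ <-].
exists z => //; apply: cvg_near_cst; apply: nearW => i.
by rewrite subrr /l2_norm l2_sqnorm0 sqrtr0.
Qed.

(** Test matrices for the lower bound: the norm is that of [z] and the limit is the synthesis of
    [z]. *)
Definition const_Bs (z : L -> F) (z2 : l2 z) : Bs R k N r :=
  Build_Bs (const_Bs_mem z2).

Lemma B_norm_const (z : L -> F) (z2 : l2 z) : B_norm (const_Bs z2) = l2_norm z.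
Proof.
rewrite /B_norm -[RHS]sup1; congr sup.
apply/seteqP; split=> [_ [i _ <-] //|_ ->]; exists (Lambda_even 0) => //.
Qed.

Lemma BsP (T : Bs R k N r) : Bs_l2_linfty (T : L -> L -> F).
Proof. exact/set_mem/Bs_matrixP. Qed.

Lemma Bs_row_l2 (T : Bs R k N r) i : l2 (T i).
Proof. by case: (BsP T) => -[]. Qed.

Lemma l2_norm_row_le (T : Bs R k N r) i : l2_norm (T i) <= B_norm T.
Proof. by apply: ub_le_sup; [case: (BsP T) => -[] | exists i]. Qed.

Lemma l2_0 : l2 (0 : L -> F).
Proof. by rewrite /l2 /mkset; have -> := @l2_sqnorm0 R k L; rewrite ltry. Qed.

Lemma l2_norm0 : l2_norm (0 : L -> F) = 0.
Proof. by rewrite /l2_norm; have -> := @l2_sqnorm0 R k L; rewrite sqrtr0. Qed.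

Lemma B_norm_const0 : B_norm (const_Bs l2_0) = 0.
Proof. exact: etrans (B_norm_const l2_0) l2_norm0. Qed.

(** * The limit operator and its norm *)

Section limit_operator.
Variables (H : completeNormedModType F) (ip : {dot H for scalar_conj R k}).
Hypothesis ip_norm : forall x : H, `|x| ^+ 2 = ip x x.
Variables (g : L -> H) (b : R).
Hypotheses (b0 : 0 < b) (gb : bessel_bound ip g b).

(** Synthesis is linear and bounded, so the distance at row [i] is at most [Num.sqrt b] times the
    [l2] distance from [T i] to [z]. *)
Lemma row_sum_cvg (T : Bs R k N r) (z : L -> F) : l2 z ->
  (fun i => l2_norm (T i - z)) @ Lambda_oo R N r --> (0 : R) ->
  row_sum g T @ Lambda_oo R N r --> synthesis g z.
Proof.
move=> z2 /cvgrPdist_lt Tz; apply/cvg_rnormP => e e0.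
have sb0 : 0 < Num.sqrt b by rewrite sqrtr_gt0.
have := Tz (e / Num.sqrt b); rewrite divr_gt0// => /(_ isT).
apply: filterS => i; rewrite sub0r normrN ger0_norm ?sqrtr_ge0// ltr_pdivlMr//.
move=> Ti; rewrite -rnormN opprB /row_sum -/(synthesis g (T i)).
have -> : synthesis g (T i) - synthesis g z = synthesis g (T i - z).
  rewrite addrC -scaleN1r -(synthesisZD ip_norm b0 gb)//; last exact: Bs_row_l2.
  by rewrite scaleN1r addrC.
rewrite (le_lt_trans _ Ti)// mulrC; apply: (rnorm_synthesis_le ip_norm b0 gb).
rewrite addrC -scaleN1r; apply: l2ZD => //; exact: Bs_row_l2.
Qed.

Lemma row_sum_is_cvg (T : Bs R k N r) : cvg (row_sum g T @ Lambda_oo R N r).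
Proof.
by have [_ [z z2 Tz]] := BsP T; apply/cvg_ex; exists (synthesis g z); exact: row_sum_cvg.
Qed.

Lemma lim_mx_cvg (T : Bs R k N r) : row_sum g T @ Lambda_oo R N r --> lim_mx g T.
Proof. exact: row_sum_is_cvg. Qed.

Lemma lim_mx_const (z : L -> F) (z2 : l2 z) : lim_mx g (const_Bs z2) = synthesis g z.
Proof.
apply: (cvg_lim (@norm_hausdorff _ _)); apply: row_sum_cvg => //.
apply: cvg_near_cst; apply: nearW => i.
by rewrite subrr /l2_norm l2_sqnorm0 sqrtr0.
Qed.

Lemma lim_mx_linear : linear (lim_mx g : Bs R k N r -> H).
Proof.
move=> c S T; apply: (cvg_lim (@norm_hausdorff _ _)).
rewrite (_ : row_sum g _ = fun i => c *: row_sum g S i + row_sum g T i).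
  by apply: cvgD; [apply: cvgZr|]; exact: lim_mx_cvg.
apply/funext => i; rewrite -[LHS]/(synthesis g (c *: (S i : L -> F) + T i)).
exact: (synthesisZD ip_norm b0 gb c (Bs_row_l2 S i) (Bs_row_l2 T i)).
Qed.

Lemma rnorm_lim_mx_le (T : Bs R k N r) :
  rnorm (lim_mx g T) <= Num.sqrt b * B_norm T.
Proof.
apply: (rnorm_lim_le _ (lim_mx_cvg (T := T))) => i.
apply: (le_trans (rnorm_synthesis_le ip_norm b0 gb (Bs_row_l2 T i))).
by rewrite ler_wpM2l ?sqrtr_ge0// l2_norm_row_le.
Qed.

Lemma rnorm_lim_mx_le_sqrt (T : Bs R k N r) : B_norm T <= 1 ->
  rnorm (lim_mx g T) <= Num.sqrt b.
Proof.
move=> T1; rewrite (le_trans (rnorm_lim_mx_le T))//.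
by rewrite -[leRHS]mulr1 ler_wpM2l ?sqrtr_ge0.
Qed.

Lemma op_norm_le : op_norm (lim_mx g : Bs R k N r -> H) <= Num.sqrt b.
Proof.
apply: ge_sup => [|_ [T T1 <-]]; last exact: rnorm_lim_mx_le_sqrt.
(* [ge_sup] requires a nonempty set; the zero matrix lies in the unit ball. *)
exists (rnorm (lim_mx g (const_Bs l2_0))), (const_Bs l2_0) => //=.
by rewrite B_norm_const0.
Qed.

(** A real [sup] dominates its set once the set is bounded above; [Num.sqrt b] is such a bound. *)
Lemma rnorm_lim_mx_le_op_norm (T : Bs R k N r) : B_norm T <= 1 ->
  rnorm (lim_mx g T) <= op_norm (lim_mx g : Bs R k N r -> H).
Proof.
move=> T1; apply: ub_le_sup; last by exists T.
by exists (Num.sqrt b) => _ [S S1 <-]; exact: rnorm_lim_mx_le_sqrt.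
Qed.

Lemma op_norm_ge0 : 0 <= op_norm (lim_mx g : Bs R k N r -> H).
Proof.
apply: (le_trans (rnorm_ge0 (lim_mx g (const_Bs l2_0)))).
apply: rnorm_lim_mx_le_op_norm.
by rewrite B_norm_const0.
Qed.

(** The coefficients, set to zero outside [A] and scaled to unit [l2] norm, are the common row of a
    matrix in the unit ball; scaling back gives the inequality. *)
Lemma synthesis_le_op_norm (A : {fset L}) (a : L -> F) :
  rnorm (\sum_(j <- A) a j *: g j) ^+ 2 <=
  op_norm (lim_mx g : Bs R k N r -> H) ^+ 2 * \sum_(j <- A) rnorm (a j) ^+ 2.
Proof.
set s := \sum_(j <- A) rnorm _ ^+ 2; set M := op_norm _.
have s0 : 0 <= s by apply: sumr_ge0 => j _; exact: sqr_ge0.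
(* For [s] zero there is nothing to scale, and the bound with [b] makes the sum vanish. *)
have [s00|sn0] := eqVneq s 0.
  rewrite s00 mulr0; apply: (le_trans (synthesis_le ip_norm _ _ b0 gb)).
  by rewrite -/s s00 mulr0.
have n0 : 0 < Num.sqrt s by rewrite sqrtr_gt0 lt_neqAle eq_sym sn0.
pose c := of_real k (Num.sqrt s)^-1.
have rc : rnorm c = (Num.sqrt s)^-1 by rewrite rnorm_of_real// invr_ge0 ltW.
pose z j := if j \in A then c * a j else 0.
have zA j : j \notin A -> z j = 0 by rewrite /z => /negbTE ->.
have zs : l2_sqnorm z = 1%:E.
  rewrite (l2_sqnorm_finite_support zA); congr (_%:E).
  rewrite (eq_fbigr _ (G := fun j => s^-1 * rnorm (a j) ^+ 2)) => [|j jA _].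
    by rewrite -mulr_sumr mulVf.
  by rewrite /z jA rnormM exprMn rc exprVn sqr_sqrtr.
have z2 : l2 z by rewrite /l2 /= zs ltry.
have := @rnorm_lim_mx_le_op_norm (const_Bs z2).
rewrite B_norm_const /l2_norm zs /= sqrtr1 lexx => /(_ isT).
rewrite lim_mx_const (synthesis_finite_support _ zA).
rewrite (eq_fbigr _ (G := fun j => c *: (a j *: g j))) => [|j jA _]; last first.
  by rewrite /z jA scalerA.
rewrite -scaler_sumr rnormZ rc mulrC ler_pdivrMr// -/M => sM.
rewrite -[X in _ * X]sqr_sqrtr// -exprMn ler_pXn2r ?nnegrE ?rnorm_ge0//.
by rewrite mulr_ge0 ?op_norm_ge0// ltW.
Qed.

(** The squared operator norm is a Bessel bound, so minimality puts [b] below it; since the operator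
    norm is nonnegative, square roots give the claim. *)
Lemma sqrt_le_op_norm : (forall b', bessel_bound ip g b' -> b <= b') ->
  Num.sqrt b <= op_norm (lim_mx g : Bs R k N r -> H).
Proof.
move=> b_min; rewrite -[leRHS]ger0_norm ?op_norm_ge0// -sqrtr_sqr ler_wsqrtr//.
apply/b_min/(synthesis_le_bessel ip_norm); first exact: sqr_ge0.
exact: synthesis_le_op_norm.
Qed.

End limit_operator.
End Lambda.

(** [summability.sum] and [lim] return default values without convergence, so convergence of each
    row sum and of the net of row sums is asserted separately. *)
Theorem theorem3p10 (R : realType) (k : scalar_kind)
    (N r : nat) (hN : (1 <= N)%N) (hr_odd : odd r) (hr_coprime : coprime r N)
    (hr_bounds : (1 <= r <= 2 * N - 1)%N)
    (H : completeNormedModType (scalar_field R k))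
    (ip : {dot H for scalar_conj R k})
    (ip_norm : forall x : H, `|x| ^+ 2 = ip x x)
    (H_infinite : infinite_dimensional H) (H_separable : separable_space H)
    (g : Lambda_set R N r -> H) (beta : R) (beta_gt0 : 0 < beta)
    (g_bessel : optimal_bessel_bound ip g beta) :
  (forall T : Bs R k N r,
      (forall i : Lambda_set R N r,
         cvg (summability.partial_sum (fun j => T i j *: g j)
                @ summability.totally)) /\
      cvg (row_sum g T @ Lambda_oo R N r)) /\
  (linear (lim_mx g : Bs R k N r -> H) /\
   bounded_op (lim_mx g) /\
   op_norm (lim_mx g) = Num.sqrt beta).
Proof.
have [gb b_min] := g_bessel.
split=> [T|].
  split=> [i|]; last exact: (row_sum_is_cvg ip_norm beta_gt0 gb).
  exact: (synthesis_is_cvg ip_norm beta_gt0 gb (Bs_row_l2 T i)).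
split; first exact: (lim_mx_linear ip_norm beta_gt0 gb).
split.
  by exists (Num.sqrt beta) => T; exact: (rnorm_lim_mx_le ip_norm beta_gt0 gb).
apply/eqP; rewrite eq_le (op_norm_le ip_norm beta_gt0 gb) /=.
exact: (sqrt_le_op_norm ip_norm beta_gt0 gb).
Qed.
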